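(* Let $\Delta$ be a unit interval pure $(m-1)$-dimensional simplicial complex on $[n]$. Let $\mathbf m$ be a monomial in $R[\mathrm{in}_>(J_\Delta)\cdot t]$. Then there exists a unique clique-sorted monomial $\mathbf M\in R_{\mathbf m}$. Similarly, let $\mathbf n$ be a monomial in $\mathbb K[\mathbf x_{\mathbf a}:\mathbf a\text{ a facet of }\Delta]$; then there exists a unique clique-sorted monomial $\mathbf N\in F_{\mathbf n}$.
   Context: Let $\mathbb K$ be a field, $m\le n$ positive integers, $X=(x_{ij})$ an $m\times n$ matrix of indeterminates and $R=\mathbb K[X]$. Let $\Delta$ be a pure $(m-1)$-dimensional simplicial complex on $[n]=\{1,\dots,n\}$; its $(m-1)$-dimensional faces (facets) are identified with $m$-subsets $\mathbf a=\{a_1<\dots<a_m\}$. A clique of $\Delta$ is an induced subcomplex any $m$ vertices of which lie together in a face; write $\Delta=\Delta_1\cup\dots\cup\Delta_r$ for the decomposition into maximal cliques (each with at least $m$ vertices). $\Delta$ is unit interval if the vertex set of each $\Delta_i$ is an interval $[u_i,v_i]=\{u_i,u_i+1,\dots,v_i\}$ with $u_i<v_i$, indexed so that $1=u_1<u_2<\dots<u_r$ and $v_r=n$. Thus an $m$-subset is a facet of $\Delta$ iff it is contained in some $[u_i,v_i]$; $\mathbf a\in\Delta_i$ means $\mathbf a\subseteq[u_i,v_i]$. For a facet $\mathbf a$, $i_a$ denotes the smallest index $i$ with $\mathbf a\in\Delta_i$. $[\mathbf a]$ is the maximal minor of $X$ on columns $\mathbf a$, $J_\Delta=([\mathbf a]:\mathbf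 a\text{ a facet of }\Delta)$, $>$ is the lexicographic order on $R$ with $x_{11}>x_{12}>\dots>x_{1n}>x_{21}>\dots>x_{mn}$, and $\mathbf x_{\mathbf a}=\mathrm{in}_>[\mathbf a]=x_{1a_1}\cdots x_{ma_m}$; it is known that $\mathrm{in}_>(J_\Delta)=(\mathbf x_{\mathbf a}:\mathbf a\text{ a facet})$. $\mathbf T_\Delta=\{T_{\mathbf a}:\mathbf a\text{ a facet}\}$ are new indeterminates; $\phi^*:R[\mathbf T_\Delta]\to R[\mathrm{in}_>(J_\Delta)t]\subseteq R[t]$ is the $R$-algebra map $T_{\mathbf a}\mapsto\mathbf x_{\mathbf a}t$, and $\psi^*:\mathbb K[\mathbf T_\Delta]\to\mathbb K[\mathbf x_{\mathbf a}:\mathbf a\text{ a facet}]$ is the $\mathbb K$-algebra map $T_{\mathbf a}\mapsto\mathbf x_{\mathbf a}$. $R_{\mathbf m}$ is the set of monomials $\mathbf M\in R[\mathbf T_\Delta]$ with $\phi^*(\mathbf M)=\mathbf m$; $F_{\mathbf n}$ is the set of monomials $\mathbf N\in\mathbb K[\mathbf T_\Delta]$ with $\psi^*(\mathbf N)=\mathbf n$. Every monomial of $R[\mathbf T_\Delta]$ is written $\mathbf M=\mathbf u\cdot T_{\mathbf a^1}\cdots T_{\mathbf a^k}$ with $\mathbf u$ a monomial of $R$ and $\mathbf a^1\ge\dots\ge\mathbf a^k$ lexicographically ($\mathbf a>\mathbf b$ lexicographically means $\mathbf x_{\mathbf a}>\mathbf x_{\mathbf b}$); write $\mathbf a^i=\{a^i_1<\dots<a^i_m\}$.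 Comparable means comparable in the Plücker poset, where $\mathbf a\le_p\mathbf b$ iff $a_i\le b_i$ for all $i$. $\mathbf M$ is clique-sorted if: (a) $a^i_j\le a^{i+1}_j$ for all $1\le j\le m$ and $1\le i<k$; (b) whenever $T_{\mathbf a}$ divides $\mathbf M$ and $x_{pq}$ divides $\mathbf u$, it is not the case that both $a_{p-1}<q<a_p$ (only $q<a_1$ if $p=1$) and $(\mathbf a\setminus\{a_p\})\cup\{q\}\in\Delta$; (c) whenever $\mathbf x_{\mathbf a}$ (with $\mathbf a$ a facet) divides $\mathbf u$ and $T_{\mathbf b}$ divides $\mathbf M$, with $i_a\ne i_b$ and $\mathbf a,\mathbf b$ comparable, one has $i_b\le i_a$. A monomial of $\mathbb K[\mathbf T_\Delta]$ is clique-sorted if it satisfies (a). *)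

(* Defs.v *)
From HB Require Import structures.
From mathcomp Require Import all_boot all_order all_algebra.
From mathcomp.multinomials Require Export mpoly.

Set Implicit Arguments.
Unset Strict Implicit.
Unset Printing Implicit Defensive.

Import GRing.Theory.
Local Open Scope ring_scope.

(* Everything is indexed from 0: [n] is 'I_n, and the variable x_{ij} of the
   generic m x n matrix is the variable of {mpoly K[m * n]} with the row-major
   number mxvec_index i j. *)

(* The ideal of A generated by G. *)
Inductive ideal_gen (A : comNzRingType) (G : A -> Prop) : A -> Prop :=
| ideal_gen_in g of G g : ideal_gen G g
| ideal_gen_0 : ideal_gen G 0
| ideal_gen_D f g of ideal_gen G f & ideal_gen G g : ideal_gen G (f + g)
| ideal_gen_M h f of ideal_gen G f : ideal_gen G (h * f).

(* The k-subalgebra of B generated by G. *)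
Inductive subalg_gen (k : nzRingType) (B : lalgType k) (G : B -> Prop) :
    B -> Prop :=
| subalg_gen_in g of G g : subalg_gen G g
| subalg_gen_A c : subalg_gen G c%:A
| subalg_gen_D f g of subalg_gen G f & subalg_gen G g : subalg_gen G (f + g)
| subalg_gen_M f g of subalg_gen G f & subalg_gen G g : subalg_gen G (f * g).

(* The Rees algebra A[It]; the indeterminate t is 'X. *)
Definition Rees (A : comNzRingType) (I : A -> Prop) : {poly A} -> Prop :=
  subalg_gen (fun p : {poly A} => exists2 f : A, I f & p = f *: 'X).

Section Lex.
Variable N : nat.

(* Pure lexicographic order with x_0 > x_1 > ...; the order that mpoly puts on
   monomials compares total degrees first. *)
Definition lex_lt (a b : 'X_{1..N}) : bool :=
  [exists i : 'I_N, [forall j : 'I_N, (j < i)%N ==> (a j == b j)]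
                    && (a i < b i)%N].

Definition lex_le (a b : 'X_{1..N}) : bool := (a == b) || lex_lt a b.

Definition is_lead (R : nzRingType) (f : {mpoly R[N]}) (b : 'X_{1..N}) : Prop :=
  b \in msupp f /\ forall a, a \in msupp f -> lex_le a b.

Definition initial_ideal (K : fieldType) (I : {mpoly K[N]} -> Prop) :
    {mpoly K[N]} -> Prop :=
  ideal_gen (fun g => exists f b, [/\ I f, is_lead f b & g = 'X_[b]]).

End Lex.

Section Complex.
Variables (m n : nat) (D : {set {set 'I_n}}).

Definition simplicial_complex : Prop :=
  set0 \in D /\ forall s t : {set 'I_n}, t \in D -> s \subset t -> s \in D.

(* Pure of dimension m - 1. *)
Definition pure : Prop :=
  forall s : {set 'I_n}, maxset (fun s' => s' \in D) s -> #|s| = m.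

(* A clique is an induced subcomplex, represented by its vertex set. *)
Definition clique (W : {set 'I_n}) : bool :=
  [forall s : {set 'I_n}, (s \subset W) && (#|s| == m) ==>
     [exists t : {set 'I_n}, (t \in D) && (s \subset t)]].

Definition max_clique (W : {set 'I_n}) : bool :=
  maxset (fun W' : {set 'I_n} => (m <= #|W'|)%N && clique W') W.

Definition itv (c : 'I_n * 'I_n) : {set 'I_n} :=
  [set x : 'I_n | (c.1 <= x <= c.2)%N].

(* cl lists the pairs (u_1, v_1), ..., (u_r, v_r); it is determined by D. *)
Record unit_interval (cl : seq ('I_n * 'I_n)) : Prop := {
  ui_cliques : forall W : {set 'I_n},
    max_clique W <-> exists2 c : 'I_n * 'I_n, c \in cl & W = itv c;
  ui_proper : forall c : 'I_n * 'I_n, c \in cl -> (c.1 < c.2)%N;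
  ui_sorted : sorted ltn [seq nat_of_ord c.1 | c <- cl];
  ui_first : head n [seq nat_of_ord c.1 | c <- cl] = 0%N;
  ui_last : (last 0%N [seq nat_of_ord c.2 | c <- cl]).+1 = n }.

Definition facet : finType :=
  {a : {set 'I_n} | (a \in D) && (#|a| == m)}.

Lemma facet_card (a : facet) : #|val a| = m.
Proof. by case/andP: (valP a) => _ /eqP. Qed.

(* The j-th element of a; enum_val enumerates a subset of 'I_n increasingly. *)
Definition elt (a : facet) (j : 'I_m) : 'I_n :=
  enum_val (cast_ord (esym (facet_card a)) j).

Definition le_p (a b : facet) : bool := [forall j, (elt a j <= elt b j)%N].

Definition comparable_p (a b : facet) : bool := le_p a b || le_p b a.

(* i_a - 1, for the list cl of maximal cliques. *)
Definition clique_index (cl : seq ('I_n * 'I_n)) (a : facet) : nat :=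
  find (fun c => val a \subset itv c) cl.

(* The exponent of x_a. *)
Definition xexp (a : facet) : 'X_{1..m * n} :=
  (\sum_(i < m) U_(mxvec_index i (elt a i)))%MM.

Definition lex_ge_facet (a b : facet) : bool := lex_le (xexp b) (xexp a).

End Complex.

Arguments facet m {n} D.

Section Rings.
Variables (K : fieldType) (m n : nat) (D : {set {set 'I_n}}).
Variable cl : seq ('I_n * 'I_n).

Local Notation F := (facet m D).
Local Notation R := {mpoly K[m * n]}.
Local Notation RT := {mpoly R[#|F|]}.
Local Notation KT := {mpoly K[#|F|]}.

Definition genmx : 'M[R]_(m, n) := \matrix_(i, j) 'X_(mxvec_index i j).

Definition minor (a : F) : R := \det (colsub (elt a) genmx).

Definition J : R -> Prop := ideal_gen (fun f => exists a : F, f = minor a).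

Definition xmon (a : F) : R := 'X_[xexp a].

Definition phi (M : RT) : {poly R} :=
  mmap (@polyC R) (fun k : 'I_#|F| => xmon (enum_val k) *: 'X) M.

Definition psi (N : KT) : R :=
  mmap (@mpolyC (m * n) K) (fun k : 'I_#|F| => xmon (enum_val k)) N.

Definition T_RT (a : F) : RT := 'X_(enum_rank a).
Definition T_KT (a : F) : KT := 'X_(enum_rank a).

(* The monomials u T_{a^1} ... T_{a^k}, where s = [:: a^1; ...; a^k]. *)
Definition mon_RT (u : 'X_{1..m * n}) (s : seq F) : RT :=
  ('X_[u] : R)%:MP * \prod_(a <- s) T_RT a.
Definition mon_KT (s : seq F) : KT := \prod_(a <- s) T_KT a.

Definition R_fiber (p : {poly R}) (M : RT) : Prop :=
  (exists u s, M = mon_RT u s) /\ phi M = p.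

Definition F_fiber (f : R) (N : KT) : Prop :=
  (exists s, N = mon_KT s) /\ psi N = f.

Definition cond_a (s : seq F) : Prop :=
  forall (a0 : F) (i : nat) (j : 'I_m), (i.+1 < size s)%N ->
    (elt (nth a0 s i) j <= elt (nth a0 s i.+1) j)%N.

Definition cond_b (u : 'X_{1..m * n}) (s : seq F) : Prop :=
  forall (a : F) (p : 'I_m) (q : 'I_n), a \in s ->
    (0 < u (mxvec_index p q))%N ->
    ~ [/\ forall p' : 'I_m, p'.+1 = p -> (elt a p' < q)%N,
          (q < elt a p)%N
        & q |: (val a :\ elt a p) \in D].

Definition cond_c (u : 'X_{1..m * n}) (s : seq F) : Prop :=
  forall a b : F, (xexp a <= u)%MM -> b \in s ->
    clique_index cl a <> clique_index cl b -> comparable_p a b ->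
    (clique_index cl b <= clique_index cl a)%N.

Definition clique_sorted_RT (M : RT) : Prop :=
  exists u s, [/\ M = mon_RT u s, sorted (@lex_ge_facet m n D) s,
                  cond_a s, cond_b u s & cond_c u s].

Definition clique_sorted_KT (N : KT) : Prop :=
  exists s, [/\ N = mon_KT s, sorted (@lex_ge_facet m n D) s & cond_a s].

End Rings.

(* Main.v *)
Require Import Defs.
From mathcomp Require Import all_boot all_order all_algebra perm zify.
From mathcomp.multinomials Require Import ssrcomplements.

Set Implicit Arguments.
Unset Strict Implicit.
Unset Printing Implicit Defensive.

Import Order.TTheory GRing.Theory.
Local Open Scope ring_scope.

(** A monomial of the fiber over x^u t^k is a pair (v, s), where s lists k
facets, possibly with repetitions, and u = v + (sum of the exponents of the
x_a, a in s).  So the theorem is about multisets of k facets whose exponents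
fit into u.

Such a multiset exists because every monomial of an element of in(J) is
divisible by some x_a ([initial_ideal_divisible]): the minors are a Groebner
basis.  This is proved with a connectivity form of Buchberger's criterion.
Fix a monomial w, and call two facets a and b with x_a and x_b dividing w
congruent when (w/x_a)[a] - (w/x_b)[b] is a combination of multiples of minors
with leading monomials below w.  This is an equivalence relation, so few pairs
need a syzygy:
- if a and b lie in one clique and differ in one position, the determinant
  with a repeated row gives a linear syzygy; moving one entry at a time
  then connects any two facets of the same clique;
- if a and b have no equal entries in the same position, [a][b] = [b][a] is
  enough;
- for a and b in different cliques, passing to the componentwise minimum
  and maximum reduces to a <= b; if then a_s = b_s, the facet
  that follows b before s and a from s on lies in both cliques.
When all pairs are congruent ([congruent_all]), an element of J in which
multiples of minors with the largest leading monomial w cancel can be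
rewritten below w, and the well-foundedness of the lexicographic order
concludes ([below_lead]).

On the combinatorial side, componentwise minima and maxima of facets are
facets, since the two ends of the cliques increase together.  Replacing a, b
by their minimum and maximum keeps the product of the x_a, and repeating this
sorts any list of facets into a chain ([chain_exists]).  For existence, take
fitting lists that minimize the sum of all column numbers: a violation of
(b) or (c) would allow one facet to be replaced by a smaller one
([clique_sorted_exists]).  For uniqueness, compare two clique-sorted pairs at
the first position where the chains differ, b against b'.  Wherever
b'_p < b_p, the variable x_(p, b'_p) must divide the R-part of the monomial
with b.  Lowering some entry of b to min(b, b') then contradicts (b), unless
every entry gets lowered, and in that case (c) forces b and min(b, b')
into one clique, where the first entry can be lowered ([lowering_blocked]).  Over
K[T] the same uniqueness statement applies with trivial R-part. *)

(** * The lexicographic order on exponents *)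

Section LexOrder.
Variable N : nat.
Implicit Types a b c : 'X_{1..N}.

(** This identification gives totality, transitivity and well-foundedness from
the lexicographic order on tuples. *)
Lemma lex_ltE a b :
  lex_lt a b = ((val a : N.-tuplelexi nat) < (val b : N.-tuplelexi nat))%O.
Proof.
apply/existsP/ltxi_tuplePlt => [[i /andP[/forallP eq_ab lt_ab]]|[i eq_ab lt_ab]].
  exists i; last by rewrite ltEnat.
  by move=> j lt_ji; apply/eqP; apply: (implyP (eq_ab j)).
exists i; rewrite [X in _ && X]lt_ab andbT.
by apply/forallP=> j; apply/implyP=> /eq_ab eq_j; apply/eqP.
Qed.

Lemma lex_lt_trans b a c : lex_lt a b -> lex_lt b c -> lex_lt a c.
Proof. by rewrite !lex_ltE; apply: lt_trans. Qed.

Lemma lex_ltxx a : lex_lt a a = false.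
Proof. by rewrite lex_ltE ltxx. Qed.

Lemma lex_lt_total a b : [\/ lex_lt a b, a = b | lex_lt b a].
Proof.
rewrite !lex_ltE.
have [->|neq_ab] := eqVneq a b; first by constructor 2.
have /lt_total/orP[] : (val a : N.-tuplelexi nat) != val b by [].
  by constructor 1.
by constructor 3.
Qed.

Lemma lex_lt_add2r c a b : lex_lt (a + c)%MM (b + c)%MM = lex_lt a b.
Proof.
by apply: eq_existsb => i; congr (_ && _); rewrite ?mnmDE ?ltn_add2r //;
   apply: eq_forallb => j; rewrite !mnmDE eqn_add2r.
Qed.

(** This is what makes the rewriting of elements of J terminate; it holds
because the number of variables is fixed, although degrees may grow. *)
Lemma lex_lt_wf : well_founded (@lex_lt N).
Proof.
move=> a; have [t eq_t] : {t : N.-tuplelexi nat | t = val a} by exists (val a).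
elim/(@ltxwf _ nat): t a eq_t => [P IH x|t IH a def_t].
  by elim/ltn_ind: x => x IHx; apply: IH => y; rewrite ltEnat; apply: IHx.
apply: Acc_intro => b; rewrite lex_ltE -def_t => lt_bt.
exact: IH lt_bt _ erefl.
Qed.

End LexOrder.

(** * Exponents of an m x n matrix of variables *)

Section Exponents.
Variables m n : nat.
Implicit Types (p i : 'I_m) (q j : 'I_n).

Lemma mxvec_index_eq i j p q :
  (mxvec_index i j == mxvec_index p q) = (i == p) && (j == q).
Proof.
apply/eqP/andP=> [|[/eqP-> /eqP->] //].
by move/cast_ord_inj/enum_rank_inj=> [-> ->].
Qed.

Lemma index_allpairs (S T : eqType) (s : seq S) (t : seq T) x y :
  x \in s -> y \in t ->
  index (x, y) [seq (x', y') | x' <- s, y' <- t] = (index x s * size t + index y t)%N.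
Proof.
move=> + yt; elim: s => //= z s IH; rewrite inE index_cat eq_sym.
have [->|neq_xz] := eqVneq z x => /= => [_|xs].
  by rewrite map_f // mul0n add0n (index_map (f := pair x)) // => ? ? [].
case: ifPn => [/mapP[? _ [E]]|_]; first by rewrite E eqxx in neq_xz.
by rewrite IH // size_map mulSn addnA.
Qed.

Lemma mxvec_index_val i j : mxvec_index i j = (i * n + j)%N :> nat.
Proof.
have def_enum : enum {: 'I_m * 'I_n} = [seq (x, y) | x <- enum 'I_m, y <- enum 'I_n].
  by rewrite enumT unlock.
have lt_r : (enum_rank (i, j) < size (enum {: 'I_m * 'I_n}))%N by rewrite -cardE.
rewrite /= -(index_uniq (i, j) lt_r) ?enum_uniq // nth_enum_rank def_enum.
by rewrite index_allpairs ?mem_enum // !index_enum_ord size_enum_ord.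
Qed.

(** The matrix form of the lexicographic order: rows are compared from the top,
and each row from the left. *)
Lemma lex_lt_rows (u v : 'X_{1..m * n}) i j :
  (forall p q, (p < i)%N || (p == i) && (q < j)%N ->
     u (mxvec_index p q) = v (mxvec_index p q)) ->
  (u (mxvec_index i j) < v (mxvec_index i j))%N -> lex_lt u v.
Proof.
move=> eq_uv lt_uv; apply/existsP; exists (mxvec_index i j).
rewrite lt_uv andbT; apply/forallP=> k; apply/implyP.
case/mxvec_indexP: k => p q; rewrite !mxvec_index_val => lt_pq.
apply/eqP/eq_uv; rewrite -val_eqE /=; move: (ltn_ord q) (ltn_ord j); nia.
Qed.

Lemma mnm_rowsP (u v : 'X_{1..m * n}) :
  (forall i j, u (mxvec_index i j) = v (mxvec_index i j)) -> u = v.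
Proof. by move=> eq_uv; apply/mnmP=> k; case/mxvec_indexP: k. Qed.

(** The exponent of x_(0, g 0) ... x_(m-1, g (m-1)); it is [xexp] for
increasing g, and gives the other terms of a minor when g is permuted. *)
Definition rows_exp (g : 'I_m -> 'I_n) : 'X_{1..m * n} :=
  (\sum_(i < m) U_(mxvec_index i (g i)))%MM.

Lemma rows_expE g i j : rows_exp g (mxvec_index i j) = (g i == j).
Proof.
rewrite mnm_sumE (bigD1 i) //= mnm1E mxvec_index_eq eqxx /= big1 ?addn0 //.
by move=> k neq_ki; rewrite mnm1E mxvec_index_eq (negPf neq_ki).
Qed.

End Exponents.

(** * Facets as increasing functions *)

Section Facets.
Variables (m n : nat) (D : {set {set 'I_n}}).
Local Notation F := (facet m D).
Implicit Types a b c : F.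

Lemma xexpE a i j : xexp a (mxvec_index i j) = (elt a i == j).
Proof. exact: rows_expE. Qed.

Lemma elt_lt a i j : (elt a i < elt a j)%N = (i < j)%N.
Proof.
have sz : size (enum (val a)) = m by rewrite -cardE facet_card.
have srt : sorted ltn (map val (enum (val a))).
  apply: (subseq_sorted ltn_trans (s2 := map val (enum 'I_n))).
    by apply: map_subseq; rewrite {1}/enum_mem -enumT; apply: filter_subseq.
  by rewrite val_enum_ord; apply: iota_ltn_sorted.
have eltE (x : 'I_m) : elt a x = nth 0%N (map val (enum (val a))) x :> nat.
  by rewrite (nth_map (elt a x)) ?sz // {1}/elt (enum_val_nth (elt a x)).
have homo (x y : 'I_m) : (x < y)%N -> (elt a x < elt a y)%N.
  move=> lt_xy; rewrite !eltE.
  by apply: (sorted_ltn_nth ltn_trans) => //; rewrite inE size_map sz.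
apply/idP/idP; last exact: homo.
by case: (ltngtP i j) => // [/homo|/val_inj->]; [case: ltngtP|rewrite ltnn].
Qed.

Lemma elt_inj a : injective (elt a).
Proof.
move=> i j eq_ij; apply: val_inj => /=.
by have := elt_lt a i j; have := elt_lt a j i; rewrite eq_ij ltnn; lia.
Qed.

Lemma elt_le a i j : (elt a i <= elt a j)%N = (i <= j)%N.
Proof. by rewrite leqNgt elt_lt -leqNgt. Qed.

Lemma val_facet a : val a = [set elt a j | j : 'I_m].
Proof.
apply/esym/eqP; rewrite eqEcard facet_card card_imset ?card_ord ?leqnn //; last exact: elt_inj.
by rewrite andbT; apply/subsetP=> _ /imsetP[j _ ->]; apply: enum_valP.
Qed.

Lemma increasing_image_eq (f g : 'I_m -> 'I_n) :
  {homo f : i j / (i < j)%N} -> {homo g : i j / (i < j)%N} ->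
  [set f j | j : 'I_m] = [set g j | j : 'I_m] -> f =1 g.
Proof.
have srt (h : 'I_m -> 'I_n) : {homo h : i j / (i < j)%N} ->
    sorted ltn [seq val (h j) | j <- enum 'I_m].
  move=> hh; rewrite (map_comp val h) sorted_map /= sorted_map.
  have: sorted ltn (map val (enum 'I_m)) by rewrite val_enum_ord iota_ltn_sorted.
  by rewrite sorted_map; apply: sub_sorted => i j /hh.
move=> hf hg eq_fg i.
have /(irr_sorted_eq ltn_trans ltnn) E :=  srt _ hf.
have {E} E := E _ (srt _ hg).
have /eq_in_map E1 : [seq val (f j) | j <- enum 'I_m] = [seq val (g j) | j <- enum 'I_m].
  apply: E => x; apply/mapP/mapP => [[j _ ->]|[j _ ->]].
    have: f j \in [set g j | j : 'I_m] by rewrite -eq_fg imset_f.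
    by case/imsetP=> k _ ->; exists k; rewrite ?mem_enum.
  have: g j \in [set f j | j : 'I_m] by rewrite eq_fg imset_f.
  by case/imsetP=> k _ ->; exists k; rewrite ?mem_enum.
by apply: val_inj; apply: E1; rewrite mem_enum.
Qed.

Lemma eq_facet a b : elt a =1 elt b -> a = b.
Proof.
move=> eq_ab; apply: val_inj; rewrite !val_facet.
exact: eq_imset.
Qed.

Lemma facet_exists (g : 'I_m -> 'I_n) : {homo g : i j / (i < j)%N} ->
  [set g j | j : 'I_m] \in D -> exists a, elt a =1 g.
Proof.
move=> hg gD.
have inj_g : injective g.
  move=> i j eq_ij; apply: val_inj => /=.
  by case: (ltngtP i j) => // /hg; rewrite eq_ij ltnn.
have ok : ([set g j | j : 'I_m] \in D) && (#|[set g j | j : 'I_m]| == m).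
  by rewrite gD card_imset // card_ord eqxx.
exists (exist (fun s : {set 'I_n} => (s \in D) && (#|s| == m)) _ ok).
apply: increasing_image_eq => //.
  by move=> i j; rewrite elt_lt.
by rewrite -val_facet.
Qed.

Lemma le_pP a b : reflect (forall j, (elt a j <= elt b j)%N) (le_p a b).
Proof. exact: forallP. Qed.

Lemma le_p_trans : transitive (@le_p m n D).
Proof.
by move=> b a c /le_pP le_ab /le_pP le_bc; apply/le_pP=> j; apply: leq_trans (le_bc j).
Qed.

Lemma le_p_lex_ge a b : le_p a b -> lex_ge_facet a b.
Proof.
move=> /le_pP le_ab; rewrite /lex_ge_facet /lex_le.
have [->|neq_ab] := eqVneq a b; first by rewrite eqxx.
have [i neq_i] : exists i, elt a i != elt b i.
  apply/existsP; apply: contraR neq_ab => /existsPn eq_ab.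
  by apply/eqP/eq_facet => i; apply/eqP; move: (eq_ab i); rewrite negbK.
have [k nk kmin] := @arg_minnP _ i (fun i => elt a i != elt b i) val neq_i.
apply/orP; right; apply: (@lex_lt_rows _ _ _ _ k (elt a k)).
  move=> p q; rewrite !xexpE => /orP[lt_pk|/andP[/eqP-> lt_q]].
    suff ->: elt a p = elt b p by [].
    by apply/eqP/negP => /negP/kmin; rewrite leqNgt lt_pk.
  by rewrite -!val_eqE /=; have := le_ab k; lia.
by rewrite !xexpE eqxx eq_sym (negPf nk).
Qed.

End Facets.

(** * Chains of facets of a unit interval complex *)

Section UnitInterval.
Variables (m n : nat) (D : {set {set 'I_n}}) (cl : seq ('I_n * 'I_n)).
Hypothesis D_complex : simplicial_complex D.
Hypothesis D_ui : unit_interval m D cl.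
Local Notation F := (facet m D).
Implicit Types (a b c d : F) (s : seq F) (I : 'I_n * 'I_n).

Definition inside (I : 'I_n * 'I_n) a := [forall j, (I.1 <= elt a j <= I.2)%N].

Lemma insideP I a :
  reflect (forall j, (I.1 <= elt a j <= I.2)%N) (inside I a).
Proof. exact: forallP. Qed.

Lemma inside_sub I a : inside I a = (val a \subset itv I).
Proof.
rewrite val_facet; apply/insideP/subsetP => [in_a _ /imsetP[j _ ->]|sub_a j].
  by rewrite inE.
by have /sub_a : elt a j \in [set elt a k | k : 'I_m] by [apply: imset_f]; rewrite inE.
Qed.

(** The clique property puts s into a face, and faces are closed under taking
subsets. *)
Lemma itv_subset_in I (s : {set 'I_n}) :
  I \in cl -> s \subset itv I -> #|s| = m -> s \in D.
Proof.
move=> clI sI card_s; have [_ downD] := D_complex.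
have /maxsetp/andP[_ /forallP/(_ s)] : max_clique m D (itv I).
  by apply/(ui_cliques D_ui); exists I.
by rewrite sI card_s eqxx /= => /existsP[t /andP[tD st]]; apply: downD st.
Qed.

Lemma facet_inside a : exists2 I, I \in cl & inside I a.
Proof.
have /(@maxset_exists _ (fun W => (m <= #|W|)%N && clique m D W))[W maxW aW] :
    (m <= #|val a|)%N && clique m D (val a).
  rewrite facet_card leqnn /=; apply/forallP=> s; apply/implyP=> /andP[sa _].
  by apply/existsP; exists (val a); rewrite sa; case/andP: (valP a) => ->.
have /(ui_cliques D_ui)[I clI def_W] := maxW.
by exists I; rewrite // inside_sub -def_W.
Qed.

Lemma facet_of_inside I (g : 'I_m -> 'I_n) : I \in cl ->
  {homo g : i j / (i < j)%N} -> (forall j, (I.1 <= g j <= I.2)%N) ->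
  exists2 a, elt a =1 g & inside I a.
Proof.
move=> clI hg in_g; have inj_g : injective g.
  move=> i j eq_ij; apply: val_inj => /=.
  by case: (ltngtP i j) => // /hg; rewrite eq_ij ltnn.
have [|a def_a] := @facet_exists _ _ D _ hg.
  apply: itv_subset_in clI _ _; last by rewrite card_imset ?card_ord.
  by apply/subsetP=> _ /imsetP[j _ ->]; rewrite inE.
by exists a => //; apply/insideP => j; rewrite def_a.
Qed.

(** Otherwise the interval I would strictly contain I', against the maximality
of the clique I'. *)
Lemma cl_ends_mono I I' : I \in cl -> I' \in cl ->
  (I.1 <= I'.1)%N -> (I.2 <= I'.2)%N.
Proof.
move=> clI clI' le_uu; rewrite leqNgt; apply/negP=> lt_vv.
have maxI' : max_clique m D (itv I') by apply/(ui_cliques D_ui); exists I'.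
have /maxsetp cqI : max_clique m D (itv I) by apply/(ui_cliques D_ui); exists I.
have /setP/(_ I.2) : itv I = itv I'.
  apply: (maxsetsup maxI' cqI); apply/subsetP=> x; rewrite !inE; lia.
by rewrite !inE leqnn /=; have := ui_proper D_ui clI; lia.
Qed.

(** The minimum stays in the clique that starts first: its entries are at most
those of a, and at least the smaller of the two left ends. *)
Lemma meet_inside I I' a b : I \in cl -> I' \in cl -> (I.1 <= I'.1)%N ->
  inside I a -> inside I' b ->
  exists2 c, (forall j, elt c j = minn (elt a j) (elt b j) :> nat) & inside I c.
Proof.
move=> clI clI' le_uu /insideP Ia /insideP Ib.
pose g j := if (elt a j <= elt b j)%N then elt a j else elt b j.
have val_g j : g j = minn (elt a j) (elt b j) :> nat by rewrite /g; case: leqP; lia.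
have [i j lt_ij|j|c def_c Ic] := facet_of_inside (g := g) clI.
- by rewrite !val_g; have := elt_lt a i j; have := elt_lt b i j; lia.
- by rewrite val_g; have := Ia j; have := Ib j; lia.
by exists c => // j; rewrite def_c.
Qed.

(** Dually, the maximum stays in the clique that ends last. *)
Lemma join_inside I I' a b : I \in cl -> I' \in cl -> (I.1 <= I'.1)%N ->
  inside I a -> inside I' b ->
  exists2 c, (forall j, elt c j = maxn (elt a j) (elt b j) :> nat) & inside I' c.
Proof.
move=> clI clI' le_uu /insideP Ia /insideP Ib.
pose g j := if (elt a j <= elt b j)%N then elt b j else elt a j.
have val_g j : g j = maxn (elt a j) (elt b j) :> nat by rewrite /g; case: leqP; lia.
have le_vv := cl_ends_mono clI clI' le_uu.
have [i j lt_ij|j|c def_c Ic] := facet_of_inside (g := g) clI'.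
- by rewrite !val_g; have := elt_lt a i j; have := elt_lt b i j; lia.
- by rewrite val_g; have := Ia j; have := Ib j; lia.
by exists c => // j; rewrite def_c.
Qed.

Lemma meet_exists a b :
  exists c, forall j, elt c j = minn (elt a j) (elt b j) :> nat.
Proof.
have [[I clI Ia] [I' clI' Ib]] := (facet_inside a, facet_inside b).
case: (leqP I.1 I'.1) => [le_uu|/ltnW le_uu].
  by have [c def_c _] := meet_inside clI clI' le_uu Ia Ib; exists c.
have [c def_c _] := meet_inside clI' clI le_uu Ib Ia.
by exists c => j; rewrite minnC.
Qed.

Lemma join_exists a b :
  exists c, forall j, elt c j = maxn (elt a j) (elt b j) :> nat.
Proof.
have [[I clI Ia] [I' clI' Ib]] := (facet_inside a, facet_inside b).
case: (leqP I.1 I'.1) => [le_uu|/ltnW le_uu].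
  by have [c def_c _] := join_inside clI clI' le_uu Ia Ib; exists c.
have [c def_c _] := join_inside clI' clI le_uu Ib Ia.
by exists c => j; rewrite maxnC.
Qed.

Lemma clique_index_lt a : (clique_index cl a < size cl)%N.
Proof.
rewrite -has_find; apply/hasP.
by have [I clI] := facet_inside a; rewrite inside_sub; exists I.
Qed.

Lemma inside_clique_index I0 a :
  inside (nth I0 cl (clique_index cl a)) a.
Proof.
rewrite inside_sub; apply: (nth_find I0 (a := fun I => val a \subset itv I)).
by rewrite has_find clique_index_lt.
Qed.

Lemma clique_index_le I0 i a :
  inside (nth I0 cl i) a -> (clique_index cl a <= i)%N.
Proof.
rewrite inside_sub => ai; rewrite leqNgt; apply/negP=> /(before_find I0).
by rewrite ai.
Qed.

Lemma cl_nth_lt I0 i j : (i < size cl)%N -> (j < size cl)%N ->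
  ((nth I0 cl i).1 < (nth I0 cl j).1)%N -> (i < j)%N.
Proof.
move=> lti ltj lt_ij; case: (ltngtP i j) lt_ij => // [lt_ji|->]; last by rewrite ltnn.
have := sorted_ltn_nth ltn_trans 0%N (ui_sorted D_ui).
move=> /(_ j i); rewrite !inE !size_map !(nth_map I0) // => /(_ ltj lti lt_ji).
by case: ltngtP.
Qed.

(** If a is not in the first clique containing b, it must leave it on the
left, so it lies in an earlier clique. *)
Lemma clique_index_mono a b : le_p a b ->
  (clique_index cl a <= clique_index cl b)%N.
Proof.
move=> /le_pP le_ab; have [I0 /(nthP I0)[i lti <-] /insideP Ia] := facet_inside a.
have ltj := clique_index_lt b; have /insideP Jb := inside_clique_index I0 b.
set j := clique_index cl b in ltj Jb *.
case: (ltnP (nth I0 cl i).1 (nth I0 cl j).1) => [lt_ij|le_ji].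
  apply: leq_trans (ltnW (cl_nth_lt lti ltj lt_ij)).
  by apply: (@clique_index_le I0); apply/insideP.
apply: (@clique_index_le I0); apply/insideP => k.
have [/andP[_ le_bv] /andP[le_ua _]] := (Jb k, Ia k).
by rewrite (leq_trans le_ji le_ua) (leq_trans (le_ab k) le_bv).
Qed.

Lemma clique_index_eq_inside a b : clique_index cl a = clique_index cl b ->
  exists I, [/\ I \in cl, inside I a & inside I b].
Proof.
move=> eq_ab; have [I0 _ _] := facet_inside a.
exists (nth I0 cl (clique_index cl a)); split.
- by rewrite mem_nth ?clique_index_lt.
- exact: inside_clique_index.
by rewrite eq_ab inside_clique_index.
Qed.

(** If q already belongs to a, the exchanged set is a subset of a, and
otherwise it is another m-subset of the same clique. *)
Lemma exchange_in I a p (q : 'I_n) : I \in cl -> inside I a ->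
  (I.1 <= q <= I.2)%N -> q |: (val a :\ elt a p) \in D.
Proof.
move=> clI Ia Iq; have a_p : elt a p \in val a by apply: enum_valP.
have [_ downD] := D_complex.
have [qa|nqa] := boolP (q \in val a).
  apply: (downD _ (val a)); first by case/andP: (valP a).
  by rewrite subUset sub1set qa subD1set.
apply: itv_subset_in clI _ _.
  rewrite subUset sub1set inE Iq (subset_trans (subD1set _ _)) //.
  by rewrite -inside_sub.
rewrite cardsU1 !inE (negPf nqa) andbF /= add1n.
by have := cardsD1 (elt a p) (val a); rewrite a_p facet_card.
Qed.

(** The exponent of the product of the x_a. *)
Definition total s := (\sum_(a <- s) xexp a)%MM.

(** In each row, the minimum and maximum are the same two columns. *)
Lemma xexp_meet_join a b c d :
  (forall j, elt c j = minn (elt a j) (elt b j) :> nat) ->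
  (forall j, elt d j = maxn (elt a j) (elt b j) :> nat) ->
  (xexp c + xexp d = xexp a + xexp b)%MM.
Proof.
move=> def_c def_d; apply: mnm_rowsP => i j.
by rewrite !mnmDE !xexpE -!val_eqE /= def_c def_d; lia.
Qed.

(** Insertion into a chain: the minimum of a and the head becomes the new head,
and the maximum is inserted into the tail.  The last conclusion says that
common lower bounds are preserved; it is what shows that the new head
stays below the rest. *)
Lemma chain_insert a s : sorted (@le_p m n D) s ->
  exists s', [/\ size s' = (size s).+1, sorted (@le_p m n D) s',
    total s' = (xexp a + total s)%MM &
    forall d, le_p d a -> all (le_p d) s -> all (le_p d) s'].
Proof.
elim: s a => [|b s IH] a srt.
  by exists [:: a]; split; rewrite // /total ?big_cons ?big_nil //= => d ->.
have [[c def_c] [d def_d]] := (meet_exists a b, join_exists a b).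
have [s' [sz_s' srt_s' tot_s' low_s']] := IH d (path_sorted srt).
have le_bs : all (le_p b) s.
  by apply: order_path_min srt; apply: le_p_trans.
have le_cb : le_p c b by apply/le_pP=> j; rewrite def_c geq_minr.
have le_all x y t : le_p x y -> all (le_p y) t -> all (le_p x) t.
  by move=> le_xy; apply: sub_all => z; apply: le_p_trans.
exists (c :: s'); split=> [||| e le_ea /= /andP[le_eb le_es]].
- by rewrite /= sz_s'.
- rewrite /= path_min_sorted //; apply: low_s'; last exact: le_all le_bs.
  by apply/le_pP=> j; rewrite def_c def_d; lia.
- rewrite /total !big_cons -!/(total _) tot_s' addmA (xexp_meet_join def_c def_d).
  by rewrite -addmA.
move: le_ea le_eb => /le_pP le_ea /le_pP le_eb; apply/andP; split.
  by apply/le_pP=> j; rewrite def_c leq_min le_ea le_eb.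
by apply: low_s' => //; apply/le_pP=> j; rewrite def_d leq_max le_ea.
Qed.

Lemma chain_exists s : exists s', [/\ size s' = size s,
  sorted (@le_p m n D) s' & total s' = total s].
Proof.
elim: s => [|a s [s1 [sz1 srt1 tot1]]]; first by exists [::].
have [s' [sz' srt' tot' _]] := chain_insert a srt1.
by exists s'; rewrite sz' tot' /total big_cons -!/(total _) tot1 /= sz1.
Qed.

Lemma cond_aE s : cond_a s <-> sorted (@le_p m n D) s.
Proof.
case: s => [|a s]; first by split.
split=> [le_s|/sortedP srt a0 i j lt_i].
  by apply/(sortedP a) => i lt_i; apply/le_pP => j; apply: le_s.
exact/le_pP/srt.
Qed.

Lemma sorted_lex_ge s :
  sorted (@le_p m n D) s -> sorted (@lex_ge_facet m n D) s.
Proof. by apply: sub_sorted => a b; apply: le_p_lex_ge. Qed.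

(** The sum of the column numbers of all variables, with multiplicity; it
depends only on the product of the x_a, so sorting a list of facets does not
change it. *)
Definition weight (e : 'X_{1..m * n}) : nat :=
  (\sum_(i < m) \sum_(j < n) e (mxvec_index i j) * j)%N.

Lemma weightD e f : weight (e + f)%MM = (weight e + weight f)%N.
Proof.
rewrite /weight -big_split; apply: eq_bigr => i _ /=.
by rewrite -big_split; apply: eq_bigr => j _ /=; rewrite mnmDE mulnDl.
Qed.

Lemma weight_xexp a : weight (xexp a) = (\sum_(i < m) elt a i)%N.
Proof.
apply: eq_bigr => i _; rewrite (bigD1 (elt a i)) //= xexpE eqxx mul1n big1 ?addn0 //.
by move=> j neq_j; rewrite xexpE eq_sym (negPf neq_j).
Qed.

Lemma weight_lt a b : le_p a b -> a != b -> (weight (xexp a) < weight (xexp b))%N.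
Proof.
move=> /le_pP le_ab neq_ab; rewrite !weight_xexp.
have [i neq_i] : exists i, elt a i != elt b i.
  apply/existsP; apply: contraR neq_ab => /existsPn eq_ab.
  by apply/eqP/eq_facet => i; apply/eqP; move: (eq_ab i); rewrite negbK.
rewrite !(bigD1 i (P := xpredT)) //= -addSn leq_add //.
  by rewrite ltn_neqAle neq_i le_ab.
by apply: leq_sum => j _; apply: le_ab.
Qed.

Lemma total_rem b s : b \in s -> total s = (xexp b + total (rem b s))%MM.
Proof.
by move=> sb; rewrite /total (perm_big _ (perm_to_rem sb)) big_cons.
Qed.

(** The set on which condition (b) is stated is the set of entries of a facet
that differs from a exactly in position p. *)
Lemma lower_exists a (p : 'I_m) (q : 'I_n) :
    (forall p' : 'I_m, p'.+1 = p -> (elt a p' < q)%N) -> (q < elt a p)%N ->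
    q |: (val a :\ elt a p) \in D ->
  exists2 b : F, elt b p = q & forall i, i != p -> elt b i = elt a i.
Proof.
move=> lt_prev lt_q inD; pose g i := if i == p then q else elt a i.
have hg : {homo g : i j / (i < j)%N}.
  move=> i j lt_ij; rewrite /g; case: eqVneq => [eq_ip|_].
    subst i; case: eqVneq => [eq_jp|_]; first by subst j; rewrite ltnn in lt_ij.
    by apply: ltn_trans lt_q _; rewrite elt_lt.
  case: eqVneq => [eq_jp|_]; last by rewrite elt_lt.
  subst j; have lt_p : (p.-1 < m)%N by have := ltn_ord p; lia.
  apply: leq_ltn_trans (lt_prev (Ordinal lt_p) _); last by rewrite /=; lia.
  by rewrite elt_le /=; lia.
have [|b def_b] := @facet_exists _ _ D _ hg.
  suff ->: [set g j | j : 'I_m] = q |: (val a :\ elt a p) by [].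
  apply/setP=> x; rewrite !inE val_facet; apply/imsetP/orP.
    move=> [j _ ->]; rewrite /g; case: (eqVneq j p) => [_|neq_j]; first by left.
    by right; rewrite (inj_eq (@elt_inj _ _ _ a)) neq_j imset_f.
  case=> [/eqP->|/andP[neq_x /imsetP[j _ def_x]]]; first by exists p; rewrite /g ?eqxx.
  by exists j => //; rewrite /g -(inj_eq (@elt_inj _ _ _ a)) -def_x (negPf neq_x).
by exists b => [|i /negPf neq_i]; rewrite def_b /g ?eqxx ?neq_i.
Qed.

(** A list of minimal weight, once sorted, works: if x_c divides x_b v for some
b in the list, replacing b by c gives another admissible list, so c cannot
have smaller weight than b.  A violation of (b) or (c) produces such a c. *)
Lemma clique_sorted_exists (u : 'X_{1..m * n}) s0 : (total s0 <= u)%MM ->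
  exists v s, [/\ (v + total s)%MM = u, size s = size s0,
    sorted (@le_p m n D) s, cond_b v s & cond_c cl v s].
Proof.
move=> le0u; pose P (t : (size s0).-tuple F) := (total t <= u)%MM.
have P0 : P (in_tuple s0) by [].
have [t Pt tmin] := arg_minnP (fun t : (size s0).-tuple F => weight (total t)) P0.
have [s [sz_s srt_s tot_s]] := chain_exists t.
rewrite size_tuple in sz_s.
have [v def_u] : exists v, u = (v + total s)%MM.
  by exists (u - total s)%MM; rewrite submK // tot_s.
have exchange b c : b \in s -> (xexp c <= xexp b + v)%MM ->
    (weight (xexp b) <= weight (xexp c))%N.
  move=> sb le_c; have tot_b := total_rem sb.
  have sz_t : size (c :: rem b s) == size s0.
    by rewrite /= size_rem // -sz_s; case: (s) sb.
  have := tmin (Tuple sz_t); rewrite /P /= -tot_s tot_b /total big_cons.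
  rewrite -!/(total _) !weightD leq_add2r; apply.
  rewrite def_u tot_b; apply/mnm_lepP=> k; rewrite !mnmDE.
  have /mnm_lepP/(_ k) := le_c; rewrite mnmDE; lia.
exists v, s; split=> //.
- move=> a p q sa v_pq [lt_prev lt_q inD].
  have [b b_p b_out] := lower_exists lt_prev lt_q inD.
  have le_ba : le_p b a.
    apply/le_pP=> i; case: (eqVneq i p) => [->|/b_out->//].
    by rewrite b_p ltnW.
  have neq_ba : b != a by apply: contraTneq lt_q => <-; rewrite b_p ltnn.
  have := weight_lt le_ba neq_ba; rewrite ltnNge => /negP; apply.
  apply: exchange sa _; apply/mnm_lepP=> k; case/mxvec_indexP: k => i j.
  rewrite mnmDE !xexpE; case: (eqVneq i p) => [->|/b_out->]; last exact: leq_addr.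
  by rewrite b_p; case: eqVneq => // <-; rewrite (leq_trans v_pq) ?leq_addl.
move=> a b le_av sb neq_idx /orP[le_ab|]; last exact: clique_index_mono.
have neq_ab : a != b by apply: contra_not_neq neq_idx => ->.
have := weight_lt le_ab neq_ab; rewrite ltnNge => /negP[].
by apply: exchange sb _; apply: lepm_trans le_av _; apply: lem_addl.
Qed.

(** The heart of uniqueness.  Let c be the minimum of b and b'.  By (b), if c
and b differ in a position p > 0, then they differ in position p - 1: otherwise
c_(p-1) = b_(p-1) < c_p and b_p could be lowered to c_p.  So the positions in
which they differ form an initial segment, and the first entry is among them.
By (b) again, no clique contains both b and the first entry of c.  If the last
entries agree, one of the cliques of b and c does; if they differ, then x_c
divides v, and (c) puts b and c into the same clique. *)
Lemma lowering_blocked (m_gt0 : (0 < m)%N) v s b b' : b \in s ->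
  cond_b v s -> cond_c cl v s ->
  (forall p, (elt b' p < elt b p)%N -> (0 < v (mxvec_index p (elt b' p)))%N) ->
  le_p b b'.
Proof.
move=> sb not_low not_early in_v; apply/le_pP=> p0; rewrite leqNgt; apply/negP=> lt_p0.
have [c def_c] := meet_exists b b'.
have le_cb : le_p c b by apply/le_pP=> j; rewrite def_c geq_minl.
have low_c p : (elt c p < elt b p)%N -> (0 < v (mxvec_index p (elt c p)))%N.
  rewrite def_c => lt_p; have lt_b' : (elt b' p < elt b p)%N by lia.
  suff ->: elt c p = elt b' p by apply: in_v.
  by apply: val_inj; rewrite /= def_c; lia.
have [J clJ Jb] := facet_inside b; have [I clI Ic] := facet_inside c.
(* By (b), b cannot be lowered at p inside a clique that contains it. *)
have blocked K (p : 'I_m) : K \in cl -> inside K b -> (elt c p < elt b p)%N ->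
    (K.1 <= elt c p)%N -> (forall p' : 'I_m, p'.+1 = p -> (elt b p' < elt c p)%N) -> False.
  move=> clK Kb lt_p Kc lt_prev.
  apply: (not_low b p (elt c p) sb (low_c p lt_p)); split=> //.
  apply: (exchange_in _ clK Kb); rewrite Kc /=.
  by have /insideP/(_ p)/andP[_] := Kb; apply: leq_trans (ltnW lt_p).
have down (p p' : 'I_m) : p'.+1 = p -> (elt c p < elt b p)%N -> (elt c p' < elt b p')%N.
  move=> def_p lt_p; rewrite ltnNge; apply/negP=> ge_p'.
  have lt_pp' : (p' < p)%N by rewrite -def_p.
  have lt_c : (elt c p' < elt c p)%N by rewrite elt_lt.
  apply: (blocked J p clJ Jb lt_p).
    have /insideP/(_ p')/andP[le_J _] := Jb; apply: leq_trans le_J _.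
    exact: leq_trans ge_p' (ltnW lt_c).
  move=> p''; rewrite -def_p => -[/val_inj->]; exact: leq_ltn_trans ge_p' lt_c.
have down_le (p p' : 'I_m) : (p' <= p)%N -> (elt c p < elt b p)%N -> (elt c p' < elt b p')%N.
  move=> le_pp'; have [k def_k] : {k | (p' + k)%N = p} by exists (p - p')%N; lia.
  elim: k p' {le_pp'} def_k => [|k IH] p' def_p lt_p.
    suff ->: p' = p by [].
    by apply: val_inj; rewrite /= -def_p addn0.
  have lt_p' : (p'.+1 < m)%N by have := ltn_ord p; lia.
  by apply: (down (Ordinal lt_p')) => //; apply: IH => //=; lia.
pose o := Ordinal m_gt0; have lt_l : (m.-1 < m)%N by rewrite prednK.
pose l := Ordinal lt_l; have le_l (p : 'I_m) : (p <= l)%N by rewrite /= -ltnS prednK.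
have lt_o : (elt c o < elt b o)%N.
  by apply: (down_le p0) => //; rewrite def_c; lia.
have fin K : K \in cl -> inside K b -> (K.1 <= elt c o)%N -> False.
  by move=> clK Kb le_K; apply: (blocked K o clK Kb lt_o le_K).
(* Compare the last entries; the second case is that they agree. *)
have [lt_cb|ge_cb] := ltnP (elt c l) (elt b l).
  have le_cv : (xexp c <= v)%MM.
    apply/mnm_lepP=> k; case/mxvec_indexP: k => i j; rewrite xexpE.
    by case: eqVneq => // <-; apply/low_c/(down_le l).
  have eq_idx : clique_index cl c = clique_index cl b.
    apply/eqP; rewrite eqn_leq clique_index_mono //=.
    case: (eqVneq (clique_index cl c) (clique_index cl b)) => [->//|/eqP neq_idx].
    by apply: (not_early _ _ le_cv sb neq_idx); rewrite /comparable_p le_cb.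
  have [K [clK /insideP/(_ o)/andP[Kc _] Kb]] := clique_index_eq_inside eq_idx.
  exact: fin clK Kb Kc.
have [le_JI|lt_IJ] := leqP J.1 I.1.
  apply: (fin J clJ Jb); have /insideP/(_ o)/andP[le_I _] := Ic.
  exact: leq_trans le_JI le_I.
have /insideP Ic' := Ic; have /andP[le_Ic _] := Ic' o.
apply: (fin I clI _ le_Ic); apply/insideP=> p.
have /andP[_ le_cI] := Ic' l; have le_bp : (elt b p <= elt b l)%N by rewrite elt_le.
have le_op : (elt b o <= elt b p)%N by rewrite elt_le.
by rewrite (leq_trans le_Ic) ?(leq_trans (ltnW lt_o)) // (leq_trans le_bp) ?(leq_trans ge_cb).
Qed.

(** Equal heads can be removed.  If b'_p < b_p for the heads b and b', no
facet of the chain of b has the entry b'_p in position p, so the variable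
comes from v ([avail]) and [lowering_blocked] applies in both directions. *)
Lemma chain_unique (m_gt0 : (0 < m)%N) v v' s s' :
  size s = size s' -> (v + total s = v' + total s')%MM ->
  sorted (@le_p m n D) s -> cond_b v s -> cond_c cl v s ->
  sorted (@le_p m n D) s' -> cond_b v' s' -> cond_c cl v' s' -> s = s'.
Proof.
have avail x y b t b' t' p : (x + total (b :: t) = y + total (b' :: t'))%MM ->
    sorted (@le_p m n D) (b :: t) -> (elt b' p < elt b p)%N ->
    (0 < x (mxvec_index p (elt b' p)))%N.
  move=> /(congr1 (fun e : 'X_{1..m * n} => e (mxvec_index p (elt b' p)))).
  rewrite !mnmDE /total !big_cons !mnmDE !xexpE eqxx => eq_u srt lt_p.
  rewrite mnm_sumE big1_seq in eq_u.
    move: eq_u; have -> : (elt b p == elt b' p) = false by rewrite -val_eqE; apply: gtn_eqF.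
    by rewrite addn0 (addn0 (x _)) => ->; rewrite addnCA.
  move=> c /= ct; rewrite xexpE -val_eqE /=.
  have /allP/(_ _ ct)/le_pP/(_ p) := order_path_min (@le_p_trans m n D) srt.
  by case: eqP => //; lia.
elim: s s' => [|b s IH] [|b' s'] //= [sz] eq_u srt nb nc srt' nb' nc'.
have eq_bb' : b = b'.
  apply: eq_facet => j; apply/val_inj/eqP; rewrite /= eqn_leq; apply/andP; split.
    apply/(le_pP _ _ _).
    apply: (lowering_blocked m_gt0 (mem_head b s) nb nc) => p; exact: avail eq_u srt.
  apply/(le_pP _ _ _).
  apply: (lowering_blocked m_gt0 (mem_head b' s') nb' nc') => p.
  exact: avail (esym eq_u) srt'.
rewrite -eq_bb' in eq_u srt' nb' nc' *; congr (_ :: _); apply: IH => //.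
- apply: (@addmI _ (xexp b)); move: eq_u; rewrite /total !big_cons.
  by rewrite !addmA ![(_ + xexp b)%MM]addmC.
- exact: path_sorted srt.
- by move=> a p q sa; apply: nb; rewrite inE sa orbT.
- by move=> a c le_a sc; apply: nc; rewrite // inE sc orbT.
- exact: path_sorted srt'.
- by move=> a p q sa; apply: nb'; rewrite inE sa orbT.
by move=> a c le_a sc; apply: nc'; rewrite // inE sc orbT.
Qed.

End UnitInterval.

(** * Leading terms of minors and combinations below a monomial *)

Section Minors.
Variables (K : fieldType) (m n : nat) (D : {set {set 'I_n}}).
Local Notation R := {mpoly K[m * n]}.
Local Notation F := (facet m D).
Implicit Types (a b : F) (f g : R) (u v w : 'X_{1..m * n}).

Definition col_minor (g : 'I_m -> 'I_n) : R := \det (colsub g (Defs.genmx K m n)).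

Lemma eq_col_minor (g h : 'I_m -> 'I_n) : g =1 h -> col_minor g = col_minor h.
Proof. by move=> eq_gh; congr (\det _); apply/matrixP => i j; rewrite !mxE eq_gh. Qed.

Lemma minorE a : minor K a = col_minor (elt a).
Proof. by []. Qed.

Lemma col_minorE (g : 'I_m -> 'I_n) :
  col_minor g = \sum_(s : 'S_m) (-1) ^+ s * 'X_[rows_exp (g \o s)].
Proof.
apply: eq_bigr => s _; congr (_ * _); rewrite /rows_exp.
rewrite (big_morph _ (@mpolyXD _ K) (@mpolyX0 _ K)).
by apply: eq_bigr => i _; rewrite !mxE.
Qed.

(** At the first row moved by s, the entry moves to the right. *)
Lemma rows_exp_perm_lt a (s : 'S_m) :
  s != 1%g -> lex_lt (rows_exp (elt a \o s)) (xexp a).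
Proof.
move=> s_neq1; have [i neq_i] : exists i, s i != i.
  apply/existsP; apply: contraR s_neq1 => /existsPn eq_s.
  by apply/eqP/permP => i; rewrite perm1; apply/eqP; move: (eq_s i); rewrite negbK.
have [k nk kmin] := @arg_minnP _ i (fun i => s i != i) val neq_i.
have fixs (p : 'I_m) : (p < k)%N -> s p = p.
  by move=> lt_pk; apply/eqP/negP => /negP/kmin; rewrite leqNgt lt_pk.
have lt_k : (k < s k)%N.
  rewrite ltn_neqAle eq_sym nk leqNgt; apply/negP=> /fixs/perm_inj eq_k.
  by rewrite eq_k eqxx in nk.
apply: (@lex_lt_rows _ _ _ _ k (elt a k)); last first.
  by rewrite xexpE rows_expE eqxx /= (inj_eq (@elt_inj _ _ _ a)) (negPf nk).
move=> p q; rewrite xexpE rows_expE /= => /orP[/fixs->//|/andP[/eqP-> lt_q]].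
by rewrite -!val_eqE /= !gtn_eqF // (ltn_trans lt_q) ?elt_lt.
Qed.

(** The identity permutation contributes x_a, and it is the largest term. *)
Lemma minor_tail a x : x \in msupp (minor K a - xmon K a) -> lex_lt x (xexp a).
Proof.
rewrite minorE col_minorE (bigD1 (1%g : 'S_m)) //= odd_perm1 expr0 mul1r.
rewrite (_ : rows_exp _ = xexp a); last first.
  by apply: eq_bigr => i _ /=; rewrite perm1.
rewrite /xmon addrAC subrr add0r => /msupp_sum_le/flattenP[l /mapP[s + ->]].
rewrite mem_filter => /andP[s_neq1 _] /=.
case: (odd_perm s) => /=; rewrite ?expr1 ?expr0; rewrite ?mulN1r ?mul1r ?(perm_mem (msuppN _)).
  by rewrite msuppX inE => /eqP->; apply: rows_exp_perm_lt.
by rewrite msuppX inE => /eqP->; apply: rows_exp_perm_lt.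
Qed.

Lemma mcoeff_minor_lead a : (minor K a)@_(xexp a) = 1.
Proof.
rewrite -[minor K a](subrK (xmon K a)) mcoeffD mcoeffX eqxx memN_msupp_eq0 ?add0r //.
by apply/negP=> /minor_tail; rewrite lex_ltxx.
Qed.

Lemma msupp_minor a x : x \in msupp (minor K a) -> lex_le x (xexp a).
Proof.
rewrite -{1}[minor K a](subrK (xmon K a)) => /msuppD_le; rewrite mem_cat.
case/orP=> [/minor_tail lt_x|]; first by rewrite /lex_le lt_x orbT.
by rewrite msuppX inE /lex_le => ->.
Qed.

Lemma msuppXM v f x :
  x \in msupp ('X_[v] * f) -> exists2 y, y \in msupp f & x = (y + v)%MM.
Proof.
by rewrite mulrC (perm_mem (msuppMX _ _)) => /mapP[y yf ->]; exists y; rewrite // addmC.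
Qed.

(** The span of the multiples of minors with leading monomial smaller than w.
It is defined inductively because the cancellations of leading terms take
place in the representations of f, which are the derivations of [below w f]. *)
Inductive below w : R -> Prop :=
| below0 : below w 0
| below_cons c v a f of lex_lt (v + xexp a)%MM w & below w f :
    below w (c *: ('X_[v] * minor K a) + f).

Lemma below_gen w c v a :
  lex_lt (v + xexp a)%MM w -> below w (c *: ('X_[v] * minor K a)).
Proof.
move=> lt_w; rewrite -[X in below _ X]addr0.
by apply: below_cons; last exact: below0.
Qed.

Lemma belowD w f g : below w f -> below w g -> below w (f + g).
Proof.
move=> bf bg; elim: bf => [|c v a h lt_w _ IH]; first by rewrite add0r.
by rewrite -addrA; apply: below_cons.
Qed.

Lemma belowZ w c f : below w f -> below w (c *: f).
Proof.
elim=> [|d v a h lt_w _ IH]; first by rewrite scaler0; apply: below0.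
by rewrite scalerDr scalerA; apply: below_cons.
Qed.

Lemma belowN w f : below w f -> below w (- f).
Proof. by rewrite -scaleN1r; apply: belowZ. Qed.

Lemma below_sum w (I : Type) (r : seq I) (P : pred I) (G : I -> R) :
  (forall i, P i -> below w (G i)) -> below w (\sum_(i <- r | P i) G i).
Proof. by move=> bG; elim/big_ind: _ => //; [apply: below0|apply: belowD]. Qed.

Lemma below_mono w w' f : lex_le w w' -> below w f -> below w' f.
Proof.
case/predU1P=> [->//|lt_w]; elim=> [|c v a h lt_v _]; first exact: below0.
by apply: below_cons; apply: lex_lt_trans lt_w.
Qed.

Lemma belowXM w v f : below w f -> below (w + v)%MM ('X_[v] * f).
Proof.
elim=> [|c u a h lt_w _ IH]; first by rewrite mulr0; apply: below0.
rewrite mulrDr -scalerAr mulrA -mpolyXD; apply: below_cons => //.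
by rewrite [(v + u)%MM]addmC -addmA [(v + _)%MM]addmC addmA lex_lt_add2r.
Qed.

Lemma below_mul_minor w f a :
  (forall x, x \in msupp f -> lex_lt (x + xexp a)%MM w) ->
  below w (f * minor K a).
Proof.
move=> lt_f; rewrite [f]mpolyE mulr_suml big_seq; apply: below_sum => x xf.
by rewrite -scalerAl; apply: below_gen; apply: lt_f.
Qed.

Lemma below_msupp w f x : below w f -> x \in msupp f -> lex_lt x w.
Proof.
elim=> [|c v a h lt_w _ IH]; first by rewrite msupp0.
move/msuppD_le; rewrite mem_cat => /orP[/msuppZ_le/msuppXM[y ya ->]|//].
case/predU1P: (msupp_minor ya) => [->|]; first by rewrite addmC.
by rewrite -(lex_lt_add2r v) [(xexp a + v)%MM]addmC => /lex_lt_trans; apply.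
Qed.

(** The two products cancel in [a][b] - [b][a], and the remaining terms involve
the tails of the minors. *)
Lemma koszul_below a b :
  below (xexp a + xexp b)%MM (xmon K b * minor K a - xmon K a * minor K b).
Proof.
rewrite (_ : _ - _ = - (minor K b - xmon K b) * minor K a
             + (minor K a - xmon K a) * minor K b); last first.
  by rewrite opprB !mulrBl [minor K b * _]mulrC; rewrite addrA subrK.
apply: belowD; apply: below_mul_minor => x.
  rewrite (perm_mem (msuppN _)) => /minor_tail.
  by rewrite [(xexp a + _)%MM]addmC lex_lt_add2r.
by move/minor_tail; rewrite lex_lt_add2r.
Qed.

(** The multiples of [a] and [b] with leading monomial w agree modulo smaller
ones; this has the intended meaning when x_a and x_b divide w. *)
Variant congruent w a b : Prop := Congruent of
  below w ('X_[w - xexp a] * minor K a - 'X_[w - xexp b] * minor K b).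

Lemma congruent_refl w a : congruent w a a.
Proof. by split; rewrite subrr; apply: below0. Qed.

Lemma congruent_sym w a b : congruent w a b -> congruent w b a.
Proof. by case=> ab; split; rewrite -opprB; apply: belowN. Qed.

Lemma congruent_trans w a b c : congruent w a b -> congruent w b c -> congruent w a c.
Proof. by case=> ab [bc]; split; have := belowD ab bc; rewrite addrA subrK. Qed.

Lemma congruent_disjoint w a b : (xexp a <= w)%MM -> (xexp b <= w)%MM ->
  (forall p, elt a p != elt b p) -> congruent w a b.
Proof.
move=> /mnm_lepP le_a /mnm_lepP le_b neq_ab.
have [z def_w] : exists z, w = (xexp a + xexp b + z)%MM.
  exists (w - (xexp a + xexp b))%MM; rewrite addmC submK //.
  apply/mnm_lepP=> k; move: (le_a k) (le_b k); case/mxvec_indexP: k => i j.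
  rewrite mnmDE !xexpE; case: (eqVneq (elt a i) j) => // <-.
  by rewrite eq_sym (negPf (neq_ab i)) addn0.
split; rewrite {2 3}def_w.
rewrite -addmA [(xexp a + _)%MM]addmC addmK [(_ + z)%MM]addmC.
rewrite -addmA [(xexp b + _)%MM]addmC addmA addmK.
rewrite !mpolyXD -!mulrA -mulrBr def_w.
by apply: belowXM; apply: koszul_below.
Qed.

End Minors.

(** * The minors are a Groebner basis *)

Section LinearSyzygy.
Variables (K : fieldType) (m n : nat).
Local Notation R := {mpoly K[m * n]}.

(** Expansion along the first row of the (m+1) x (m+1) minor in which the row i
occurs a second time on top. *)
Lemma repeated_row_syzygy (i : 'I_m) (c : 'I_m.+1 -> 'I_n) :
  \sum_(k < m.+1) (-1) ^+ k *: ('X_(mxvec_index i (c k)) * col_minor K (c \o lift k)) = 0.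
Proof.
pose row_of r := if unlift ord0 r is Some j then j else i.
pose B : 'M[R]_m.+1 := \matrix_(r, k) 'X_(mxvec_index (row_of r) (c k)).
have det0 : \det B = 0.
  apply: (@determinant_alternate _ _ _ ord0 (lift ord0 i)); first exact: neq_lift.
  by move=> k; rewrite !mxE /row_of unlift_none liftK.
rewrite -[RHS]det0 (expand_det_row B ord0); apply: eq_bigr => k _.
rewrite mxE /row_of unlift_none /cofactor add0n mulrCA.
have -> : row' ord0 (col' k B) = colsub (c \o lift k) (Defs.genmx K m n).
  by apply/matrixP => r j; rewrite !mxE /row_of liftK.
rewrite -[X in X *: _]signr_odd -[X in _ = X * _]signr_odd.
by case: (odd k); rewrite ?expr1 ?expr0 ?scaleN1r ?scale1r ?mulN1r ?mul1r.
Qed.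

End LinearSyzygy.

Section Groebner.
Variables (K : fieldType) (m n : nat) (D : {set {set 'I_n}}) (cl : seq ('I_n * 'I_n)).
Hypothesis D_complex : simplicial_complex D.
Hypothesis D_ui : unit_interval m D cl.
Local Notation R := {mpoly K[m * n]}.
Local Notation F := (facet m D).
Implicit Types (a b c d : F) (f g : R) (u v w : 'X_{1..m * n}) (I : 'I_n * 'I_n).

(** The syzygy for the union c of a and b, which has m + 1 elements: omitting
the entry i or i + 1 of c gives b or a, and all other terms have smaller
leading monomials.  If the omitted entry k is smaller than i, row k gets a
later column; if it is larger than i + 1, row i gets the column c_k instead
of c_(i+1). *)
Lemma linear_syzygy_below I a b (i : 'I_m) : I \in cl -> inside I a -> inside I b ->
  (forall p, p != i -> elt a p = elt b p) -> (elt a i < elt b i)%N ->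
  below D (xexp a + U_(mxvec_index i (elt b i)))%MM
    ('X_(mxvec_index i (elt b i)) * minor K a - 'X_(mxvec_index i (elt a i)) * minor K b).
Proof.
move=> clI Ia Ib eq_ab lt_ab.
pose i0 : 'I_m.+1 := widen_ord (leqnSn m) i; pose i1 : 'I_m.+1 := lift ord0 i.
(* c is b with the entry a_i inserted in position i, before b_i. *)
pose c k := if unlift i0 k is Some j then elt b j else elt a i.
have c_b (j : 'I_m) : c (lift i0 j) = elt b j by rewrite /c liftK.
have c_i0 : c i0 = elt a i by rewrite /c unlift_none.
have i1E : i1 = lift i0 i by apply: val_inj; rewrite /= /bump leqnn.
have c_i1 : c i1 = elt b i by rewrite i1E c_b.
have c_a (j : 'I_m) : c (lift i1 j) = elt a j.
  case: (ltngtP j i) => [lt_ji|lt_ij|/val_inj->].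
  - have -> : lift i1 j = lift i0 j by apply: val_inj; rewrite /i0 /i1 /= /bump; lia.
    by rewrite c_b eq_ab // -val_eqE /= ltn_eqF.
  - have -> : lift i1 j = lift i0 j by apply: val_inj; rewrite /i0 /i1 /= /bump; lia.
    by rewrite c_b eq_ab // -val_eqE /= gtn_eqF.
  suff -> : lift i1 i = i0 by [].
  by apply: val_inj; rewrite /i0 /i1 /= /bump; lia.
have lift_lt (j j' : 'I_m) : (lift i0 j < lift i0 j')%N -> (j < j')%N.
  by rewrite /= /bump; lia.
have lift_lt_i0 (j : 'I_m) : (lift i0 j < i0)%N -> (j < i)%N.
  by rewrite /= /bump; lia.
have i0_lt_lift (j : 'I_m) : (i0 < lift i0 j)%N -> (i <= j)%N.
  by rewrite /= /bump; lia.
have c_lt (k l : 'I_m.+1) : (k < l)%N -> (c k < c l)%N.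
  case: (unliftP i0 k) => [j ->|->]; case: (unliftP i0 l) => [j' ->|->].
  - by rewrite !c_b elt_lt; apply: lift_lt.
  - rewrite c_b c_i0 => /lift_lt_i0 lt_ji.
    by rewrite -eq_ab ?elt_lt // -val_eqE /= ltn_eqF.
  - rewrite c_b c_i0 => /i0_lt_lift le_ij.
    by apply: leq_trans lt_ab _; rewrite elt_le.
  by rewrite ltnn.
have c_I (k : 'I_m.+1) : (I.1 <= c k <= I.2)%N.
  case: (unliftP i0 k) => [j ->|->]; first by rewrite c_b; apply/insideP.
  by rewrite c_i0; apply/insideP.
set w := (xexp a + _)%MM.
have term (k : 'I_m.+1) : k != i0 -> k != i1 ->
  below D w ((-1) ^+ k *: ('X_(mxvec_index i (c k)) * col_minor K (c \o lift k)) : R).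
  rewrite -!val_eqE /i0 /i1 /= /bump leq0n add1n => neq_i0 neq_i1.
  have [|j|d def_d _] := facet_of_inside D_complex D_ui (g := c \o lift k) clI.
  - by move=> p q lt_pq; apply: c_lt; rewrite /i0 /i1 /= /bump; lia.
  - exact: c_I.
  rewrite -(eq_col_minor K def_d) -minorE; apply: below_gen; rewrite /w.
  have [lt_ki|lt_ik] : (k < i)%N \/ (i.+1 < k)%N by lia.
    have lt_km : (k < m)%N by apply: ltn_trans lt_ki _.
    pose k' : 'I_m := Ordinal lt_km.
    have def_k : lift i1 k' = k by apply: val_inj; rewrite /i0 /i1 /= /bump; lia.
    have lt_c1 : (c k < c (lift k k'))%N by apply: c_lt; rewrite /= /bump; lia.
    apply: (@lex_lt_rows _ _ _ _ k' (c k)); last first.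
      rewrite !mnmDE !mnm1E !mxvec_index_eq !xexpE def_d -c_a def_k -!val_eqE /=.
      by rewrite (gtn_eqF lt_ki) (gtn_eqF lt_c1) eqxx.
    move=> p q; rewrite !mnmDE !mnm1E !mxvec_index_eq !xexpE def_d -c_a.
    case/orP=> [lt_pk|/andP[/eqP-> lt_q]].
      have -> : lift i1 p = lift k p.
        by apply: val_inj; rewrite /i1 /= /bump; move: lt_pk => /=; lia.
      by rewrite -!val_eqE /= (gtn_eqF (ltn_trans lt_pk lt_ki)) addn0.
    rewrite def_k -!val_eqE /= (gtn_eqF lt_ki) (gtn_eqF lt_q).
    by rewrite (gtn_eqF (ltn_trans lt_q lt_c1)).
  have lt_c1 : (c i1 < c k)%N by apply: c_lt; rewrite /i1 /= /bump; lia.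
  have lt_c0 : (c i0 < c i1)%N by rewrite c_i0 c_i1.
  have lift_k (p : 'I_m) : (p <= i)%N -> lift k p = lift i1 p.
    by move=> le_pi; apply: val_inj; rewrite /i1 /= /bump; lia.
  have lift_i : lift i1 i = i0 by apply: val_inj; rewrite /i0 /i1 /= /bump; lia.
  apply: (@lex_lt_rows _ _ _ _ i (c i1)); last first.
    rewrite !mnmDE !mnm1E !mxvec_index_eq !xexpE def_d -c_a -c_i1 /= lift_k // lift_i.
    by rewrite -!val_eqE /= (gtn_eqF lt_c1) (ltn_eqF lt_c0) !eqxx.
  move=> p q; rewrite !mnmDE !mnm1E !mxvec_index_eq !xexpE def_d -c_a -c_i1 /=.
  case/orP=> [lt_pi|/andP[/eqP-> lt_q]].
    by rewrite lift_k ?(ltnW lt_pi) // -!val_eqE /= (gtn_eqF lt_pi) addn0.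
  rewrite lift_k // -!val_eqE /= (gtn_eqF lt_q) (gtn_eqF (ltn_trans lt_q lt_c1)).
  by rewrite andbF addn0.
have neq10 : i1 != i0 by rewrite -val_eqE /= /bump; lia.
have := repeated_row_syzygy K i c; rewrite (bigD1 i0) //= (bigD1 i1) //=.
rewrite c_i0 c_i1 (eq_col_minor K (c_b : c \o lift i0 =1 _)).
rewrite (eq_col_minor K (c_a : c \o lift i1 =1 _)) -!minorE.
rewrite /bump /= add1n exprS mulN1r scaleNr.
set S := \sum_(k < _ | _) _ => eq0.
have bS : below D w S by apply: below_sum => k /andP[]; apply: term.
suff -> : 'X_(mxvec_index i (elt b i)) * minor K a - 'X_(mxvec_index i (elt a i)) * minor K b
  = (-1) ^+ i *: S by apply: belowZ.
move: eq0; set X := _ * minor K a; set Y := _ * minor K b.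
rewrite addrA -scalerBr => /eqP; rewrite addrC addr_eq0 => /eqP->.
by rewrite scalerN scalerA -exprMn mulrNN mulr1 expr1n scale1r opprB.
Qed.

Lemma congruent_step I w a b (i : 'I_m) : I \in cl -> inside I a -> inside I b ->
  (xexp a <= w)%MM -> (xexp b <= w)%MM ->
  (forall p, p != i -> elt a p = elt b p) -> (elt a i < elt b i)%N ->
  congruent K w a b.
Proof.
move=> clI Ia Ib /mnm_lepP le_a /mnm_lepP le_b eq_ab lt_ab.
have eq_lead : (xexp a + U_(mxvec_index i (elt b i)) =
                xexp b + U_(mxvec_index i (elt a i)))%MM.
  apply: mnm_rowsP => p q; rewrite !mnmDE !mnm1E !mxvec_index_eq !xexpE.
  have [->|neq_pi] := eqVneq p i; first by rewrite /= addnC.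
  by rewrite eq_ab.
have [z def_w] : exists z, w = (xexp a + U_(mxvec_index i (elt b i)) + z)%MM.
  exists (w - (xexp a + U_(mxvec_index i (elt b i))))%MM; rewrite addmC submK //.
  apply/mnm_lepP=> k; move: (le_a k) (le_b k); case/mxvec_indexP: k => p q.
  rewrite mnmDE mnm1E mxvec_index_eq !xexpE.
  have [<-|_] := eqVneq i p; last by rewrite addn0.
  have [<-|_] := eqVneq (elt b i) q; last by rewrite addn0.
  by rewrite -val_eqE /= (ltn_eqF lt_ab).
split; rewrite {2}def_w -addmA [(xexp a + _)%MM]addmC addmK.
rewrite {2}def_w eq_lead -addmA [(xexp b + _)%MM]addmC addmK.
rewrite ![(_ + z)%MM]addmC !mpolyXD -!mulrA -mulrBr def_w.
by apply: belowXM; apply: (linear_syzygy_below clI).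
Qed.

(** Move from b down to a, lowering the first entries first: the intermediate
facets (a_0, ..., a_(t-1), b_t, ..., b_(m-1)) are increasing because a <= b. *)
Lemma congruent_chain I w a b : I \in cl -> inside I a -> inside I b ->
  (xexp a <= w)%MM -> (xexp b <= w)%MM -> le_p a b -> congruent K w a b.
Proof.
move=> clI Ia Ib le_a le_b /le_pP le_ab.
have /(_ m (leqnn m)) : forall t, (t <= m)%N -> exists h,
  [/\ forall p, elt h p = if (p < t)%N then elt a p else elt b p,
      inside I h, (xexp h <= w)%MM & congruent K w h b].
  elim=> [_|t IH lt_tm].
    by exists b; split=> //; apply: congruent_refl.
  have [h [def_h Ih le_h hb]] := IH (ltnW lt_tm).
  pose i : 'I_m := Ordinal lt_tm.
  have [eq_i|neq_i] := eqVneq (elt a i) (elt b i).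
    exists h; split=> // p; rewrite def_h ltnS [in RHS]leq_eqVlt.
    case: (ltngtP p t) => //= eq_pt; suff -> : p = i by rewrite eq_i.
    exact: val_inj.
  pose g (p : 'I_m) := if (p < t.+1)%N then elt a p else elt b p.
  have [|j|h' def_h' Ih'] := facet_of_inside D_complex D_ui (g := g) clI.
  - move=> p q lt_pq; rewrite /g.
    case: (ltnP p t.+1) => ltp; case: (ltnP q t.+1) => ltq; rewrite ?elt_lt //.
      by apply: leq_ltn_trans (le_ab p) _; rewrite elt_lt.
    by lia.
  - by rewrite /g; case: ifP => _; apply/insideP.
  have le_h' : (xexp h' <= w)%MM.
    apply/mnm_lepP=> k; have /mnm_lepP/(_ k) := le_a; have /mnm_lepP/(_ k) := le_b.
    case/mxvec_indexP: k => p q; rewrite !xexpE def_h' /g.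
    by case: ifP.
  exists h'; split=> //; apply: congruent_trans hb.
  apply: (@congruent_step I _ _ _ i) => //.
    move=> p neq_p; rewrite def_h' def_h /g ltnS [in LHS]leq_eqVlt.
    by rewrite -val_eqE /= in neq_p; rewrite (negPf neq_p).
  by rewrite def_h' def_h /g /= ltnSn ltnn ltn_neqAle le_ab neq_i.
case=> h [def_h _ _]; suff -> : h = a by [].
by apply: eq_facet => p; rewrite def_h ltn_ord.
Qed.

Lemma meet_divides w a b c : (forall j, elt c j = minn (elt a j) (elt b j) :> nat) ->
  (xexp a <= w)%MM -> (xexp b <= w)%MM -> (xexp c <= w)%MM.
Proof.
move=> def_c /mnm_lepP le_a /mnm_lepP le_b; apply/mnm_lepP=> k.
move: (le_a k) (le_b k); case/mxvec_indexP: k => p q; rewrite !xexpE.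
by rewrite -!val_eqE /= def_c; case: (leqP (elt a p) (elt b p)).
Qed.

Lemma join_divides w a b c : (forall j, elt c j = maxn (elt a j) (elt b j) :> nat) ->
  (xexp a <= w)%MM -> (xexp b <= w)%MM -> (xexp c <= w)%MM.
Proof.
move=> def_c /mnm_lepP le_a /mnm_lepP le_b; apply/mnm_lepP=> k.
move: (le_a k) (le_b k); case/mxvec_indexP: k => p q; rewrite !xexpE.
by rewrite -!val_eqE /= def_c; case: (leqP (elt a p) (elt b p)).
Qed.

Lemma congruent_inside I w a b : I \in cl -> inside I a -> inside I b ->
  (xexp a <= w)%MM -> (xexp b <= w)%MM -> congruent K w a b.
Proof.
move=> clI Ia Ib le_a le_b.
have [c def_c Ic] := meet_inside D_complex D_ui clI clI (leqnn _) Ia Ib.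
have le_c := meet_divides def_c le_a le_b.
apply: (@congruent_trans _ _ _ _ _ _ c); first apply: congruent_sym.
  by apply: (congruent_chain clI) => //; apply/le_pP=> j; rewrite def_c geq_minl.
by apply: (congruent_chain clI) => //; apply/le_pP=> j; rewrite def_c geq_minr.
Qed.

(** If a_s = b_s, the facet that follows b before s and a from s on starts at
b_0 and ends at a_(m-1), so it lies in both cliques. *)
Lemma congruent_le I J w a b : I \in cl -> J \in cl -> (I.1 <= J.1)%N ->
  inside I a -> inside J b -> le_p a b ->
  (xexp a <= w)%MM -> (xexp b <= w)%MM -> congruent K w a b.
Proof.
move=> clI clJ le_IJ Ia Jb /le_pP le_ab le_a le_b.
have [/existsP[s /eqP eq_s]|/existsPn neq_ab] :=
  boolP [exists s, elt a s == elt b s]; last exact: congruent_disjoint.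
pose g (p : 'I_m) := if (p < s)%N then elt b p else elt a p.
have le_vv := cl_ends_mono D_ui clI clJ le_IJ.
have {}Jb' := insideP _ _ Jb; have Ia' := insideP _ _ Ia.
have g_in p : (J.1 <= g p <= I.2)%N.
  rewrite /g; case: ltnP => [lt_ps|le_sp].
    have /andP[-> _] := Jb' p; have /andP[_ le_s] := Ia' s.
    by apply: leq_trans le_s; rewrite eq_s elt_le ltnW.
  have /andP[_ ->] := Ia' p; have /andP[le_s _] := Jb' s.
  by rewrite andbT; apply: leq_trans le_s _; rewrite -eq_s elt_le.
have [|p|c def_c Jc] := facet_of_inside D_complex D_ui (g := g) clJ.
- move=> p q lt_pq; rewrite /g.
  case: (ltnP p s) => ltp; case: (ltnP q s) => ltq; rewrite ?elt_lt //.
    apply: (@leq_trans (elt b s)); first by rewrite elt_lt.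
    by rewrite -eq_s elt_le.
  by lia.
- by have /andP[-> /leq_trans] := g_in p; apply.
have Ic : inside I c.
  apply/insideP=> p; rewrite def_c; have /andP[le_Jp ->] := g_in p.
  by rewrite (leq_trans le_IJ).
have le_c : (xexp c <= w)%MM.
  apply/mnm_lepP=> k; have /mnm_lepP/(_ k) := le_a; have /mnm_lepP/(_ k) := le_b.
  by case/mxvec_indexP: k => p q; rewrite !xexpE def_c /g; case: ifP.
apply: (@congruent_trans _ _ _ _ _ _ c); first exact: (congruent_inside clI).
exact: (congruent_inside clJ).
Qed.

(** Every pair needed in Buchberger's criterion: go from a to the minimum inside
I, from there to the maximum, and to b inside J. *)
Lemma congruent_all w a b :
  (xexp a <= w)%MM -> (xexp b <= w)%MM -> congruent K w a b.
Proof.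
have [[I clI Ia] [J clJ Jb]] :=
  (facet_inside D_ui a, facet_inside D_ui b).
wlog le_IJ : a b I J clI Ia clJ Jb / (I.1 <= J.1)%N.
  move=> wl; case: (leqP I.1 J.1) => [|/ltnW] le; first exact: wl le.
  by move=> le_a le_b; apply: congruent_sym; apply: wl le _ _.
move=> le_a le_b.
have [d def_d Id] := meet_inside D_complex D_ui clI clJ le_IJ Ia Jb.
have [e def_e Je] := join_inside D_complex D_ui clI clJ le_IJ Ia Jb.
have le_d := meet_divides def_d le_a le_b; have le_e := join_divides def_e le_a le_b.
apply: (@congruent_trans _ _ _ _ _ _ d); first exact: (congruent_inside clI).
apply: (@congruent_trans _ _ _ _ _ _ e); last exact: (congruent_inside clJ).
apply: (congruent_le clI clJ le_IJ Id Je) => //.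
by apply/le_pP=> j; rewrite def_d def_e; lia.
Qed.

(** A representation can be arranged so that a single term carries the largest
leading monomial w', because all terms with leading monomial w' are congruent
multiples of minors. *)
Lemma below_top w f : below D w f -> f = 0 \/
  exists w' a k, [/\ lex_lt w' w, (xexp a <= w')%MM &
    below D w' (f - k *: ('X_[w' - xexp a] * minor K a))].
Proof.
elim=> [|k v a g lt_w _ IH]; first by left.
right; set w1 := (v + xexp a)%MM.
have le_a1 : (xexp a <= w1)%MM by apply: lem_addl.
have def_v : v = (w1 - xexp a)%MM by rewrite addmK.
case: IH => [->|[w' [b [k' [lt_w' le_b bg]]]]].
  by exists w1, a, k; split; [by []|by []|]; rewrite addr0 -def_v subrr; apply: below0.
case: (lex_lt_total w1 w') => [lt_1|eq_1|lt_1].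
- by exists w', b, k'; split; [by []|by []|]; rewrite -addrA; apply: below_cons.
- exists w', b, (k + k'); split; [by []|by []|]; subst w'.
  rewrite def_v scalerDl opprD addrACA -scalerBr; apply: belowD => //.
  by apply: belowZ; case: (congruent_all le_a1 le_b).
exists w1, a, k; split; [by []|by []|]; rewrite -def_v addrAC subrr add0r.
rewrite -(subrK (k' *: ('X_[w' - xexp b] * minor K b)) g); apply: belowD.
  by apply: below_mono bg; rewrite /lex_le lt_1 orbT.
by apply: below_gen; rewrite submK.
Qed.

(** Either the largest term of the representation does not vanish, and then its
monomial is the leading one, or f has a representation further below. *)
Lemma below_lead w f x : below D w f -> is_lead f x ->
  exists a, (xexp a <= x)%MM.
Proof.
elim/(well_founded_ind (@lex_lt_wf (m * n))): w f => w IH f bf [fx maxx].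
have [f0|[w' [a [k [lt_w le_a bf']]]]] := below_top bf.
  by rewrite f0 msupp0 in fx.
set f' := f - _ in bf'; have [k0|k_neq0] := eqVneq k 0.
  by rewrite /f' k0 scale0r subr0 in bf'; apply: (IH w' lt_w f bf').
have fw : w' \in msupp f.
  rewrite -(subrK (k *: ('X_[w' - xexp a] * minor K a)) f) -/f' mcoeff_msupp.
  rewrite mcoeffD memN_msupp_eq0 ?add0r; last first.
    by apply/negP=> /(below_msupp bf'); rewrite lex_ltxx.
  rewrite mcoeffZ mulf_neq0 // mulrC -{1}(submK le_a) mcoeffMX.
  by rewrite mcoeff_minor_lead oner_neq0.
suff -> : x = w' by exists a.
have le_xw : lex_le x w'.
  move: fx; rewrite -(subrK (k *: ('X_[w' - xexp a] * minor K a)) f) -/f'.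
  move/msuppD_le; rewrite mem_cat => /orP[/(below_msupp bf') lt_x|].
    by rewrite /lex_le lt_x orbT.
  move/msuppZ_le/msuppXM=> [y /msupp_minor ya ->].
  have def_w : w' = (xexp a + (w' - xexp a))%MM by rewrite addmC submK.
  rewrite [X in lex_le _ X]def_w /lex_le.
  case/predU1P: ya => [->|lt_y]; first by rewrite eqxx.
  by rewrite lex_lt_add2r lt_y orbT.
case/predU1P: le_xw => // lt_xw; case/predU1P: (maxx _ fw) => // lt_wx.
by have := lex_lt_trans lt_xw lt_wx; rewrite lex_ltxx.
Qed.

Lemma J_below f : (0 < m * n)%N -> J D f -> exists w, below D w f.
Proof.
move=> mn_gt0; have bump w : lex_lt w (w + U_(Ordinal mn_gt0))%MM.
  apply/existsP; exists (Ordinal mn_gt0).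
  by rewrite mnmDE mnm1E eqxx addn1 ltnSn andbT; apply/forallP=> j.
have sup w w' : exists w2, lex_le w w2 /\ lex_le w' w2.
  rewrite /lex_le; case: (lex_lt_total w w') => [lt_w|->|lt_w].
  - by exists w'; rewrite lt_w eqxx orbT.
  - by exists w'; rewrite eqxx.
  by exists w; rewrite lt_w eqxx orbT.
have addE f1 f2 : (exists w, below D w f1) -> (exists w, below D w f2) ->
    exists w, below D w (f1 + f2).
  move=> [w1 b1] [w2 b2]; have [w [le_1 le_2]] := sup w1 w2; exists w.
  by apply: belowD; [apply: below_mono b1|apply: below_mono b2].
elim=> [_ [a ->]||f1 f2 _ IH1 _ IH2|h f1 _ [w bf]].
- exists (0 + xexp a + U_(Ordinal mn_gt0))%MM.
  have := @below_gen K m n D _ 1 _ a (bump (0 + xexp a)%MM).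
  by rewrite scale1r mpolyX0 mul1r.
- by exists 0%MM; apply: below0.
- exact: addE.
rewrite [h]mpolyE mulr_suml.
elim: (msupp h) => [|v s IH]; first by rewrite big_nil; exists 0%MM; apply: below0.
rewrite big_cons; apply: addE => //; exists (w + v)%MM.
by rewrite -scalerAl; apply: belowZ; apply: belowXM.
Qed.

Lemma initial_ideal_divisible g x : (0 < m * n)%N ->
  initial_ideal (@J K m n D) g -> x \in msupp g -> exists a, (xexp a <= x)%MM.
Proof.
move=> mn_gt0 gI.
elim: gI x => [_ [f [y [Jf lead_y ->]]]||f1 f2 _ IH1 _ IH2|h f _ IH] x.
- rewrite msuppX inE => /eqP->; have [w bf] := J_below mn_gt0 Jf.
  exact: below_lead bf lead_y.
- by rewrite msupp0.
- by move/msuppD_le; rewrite mem_cat => /orP[/IH1|/IH2].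
move/msuppM_le/allpairsP=> [[y z] /= [_ /IH[a le_a] ->]].
by exists a; apply: lepm_trans le_a _; apply: lem_addl.
Qed.

(** The coefficient of t^i lies in the i-th power of a monomial ideal. *)
Lemma Rees_divisible (p : {poly R}) : (0 < m * n)%N ->
  Rees (initial_ideal (@J K m n D)) p -> forall i x, x \in msupp p`_i ->
  exists s : seq F, size s = i /\ (total s <= x)%MM.
Proof.
move=> mn_gt0; elim=> {p} [_ [f If ->]|c|f g _ IHf _ IHg|f g _ IHf _ IHg] i x.
- rewrite coefZ coefX; case: eqP => [->|_]; last by rewrite mulr0 msupp0.
  rewrite mulr1 => /(initial_ideal_divisible mn_gt0 If)[a le_a].
  by exists [:: a]; split=> //; rewrite /total big_seq1.
- rewrite coefZ coef1; case: eqP => [->|_]; last by rewrite mulr0 msupp0.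
  by exists [::]; split=> //; rewrite /total big_nil; apply/mnm_lepP=> j; rewrite mnm0E.
- by rewrite coefD => /msuppD_le; rewrite mem_cat => /orP[/IHf|/IHg].
rewrite coefM => /msupp_sum_le/flattenP[l /mapP[j _ ->]].
move/msuppM_le/allpairsP=> [[y z] /= [/IHf[s [sz_s le_s]] /IHg[t [sz_t le_t]] ->]].
have le_ji : (j <= i)%N by rewrite -ltnS.
exists (s ++ t); split; first by rewrite size_cat sz_s sz_t subnKC.
rewrite /total big_cat; apply/mnm_lepP=> k; rewrite !mnmDE.
by apply: leq_add; [have /mnm_lepP := le_s|have /mnm_lepP := le_t].
Qed.

Lemma subalg_monomials (f : R) :
  subalg_gen (fun f => exists a : F, f = xmon K a) f ->
  forall x, x \in msupp f -> exists s : seq F, total s = x.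
Proof.
elim=> {f} [_ [a ->]|c|f g _ IHf _ IHg|f g _ IHf _ IHg] x.
- by rewrite msuppX inE => /eqP->; exists [:: a]; rewrite /total big_seq1.
- move/msuppZ_le; rewrite -mpolyX0 msuppX inE => /eqP->.
  by exists [::]; rewrite /total big_nil.
- by move/msuppD_le; rewrite mem_cat => /orP[/IHf|/IHg].
move/msuppM_le/allpairsP=> [[y z] /= [/IHf[s <-] /IHg[t <-] ->]].
by exists (s ++ t); rewrite /total big_cat.
Qed.

End Groebner.

(** * Fibers of the two parametrizations *)

Section Fibers.
Variables (K : fieldType) (m n : nat) (D : {set {set 'I_n}}).
Local Notation R := {mpoly K[m * n]}.
Local Notation F := (facet m D).

Lemma phi_mon (v : 'X_{1..m * n}) (s : seq F) :
  phi (mon_RT K v s) = 'X_[v + total s] *: 'X^(size s).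
Proof.
rewrite /phi /mon_RT rmorphM /= mmapC rmorph_prod /=.
have -> : \prod_(a <- s) mmap (polyC (R:=R))
      (fun k : 'I_#|F| => xmon K (enum_val k) *: 'X) (T_RT K a)
    = 'X_[total s] *: 'X^(size s).
  elim: s => [|a s IH]; first by rewrite big_nil /total big_nil mpolyX0 scale1r expr0.
  rewrite big_cons IH /total big_cons mmapX mmap1U enum_rankK mpolyXD exprS.
  by rewrite -scalerAl -scalerAr scalerA.
by rewrite mul_polyC scalerA mpolyXD.
Qed.

Lemma psi_mon (s : seq F) : psi (mon_KT K s) = 'X_[total s].
Proof.
rewrite /psi /mon_KT rmorph_prod /=; elim: s => [|a s IH].
  by rewrite big_nil /total big_nil mpolyX0.
by rewrite big_cons IH /total big_cons mmapX mmap1U enum_rankK mpolyXD.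
Qed.

Lemma mpolyX_inj (u v : 'X_{1..m * n}) : 'X_[u] = 'X_[v] :> R -> u = v.
Proof. by move/(congr1 (@msupp _ _)); rewrite !msuppX => -[]. Qed.

Lemma monomial_Rees_inj (u v : 'X_{1..m * n}) k l :
  'X_[u] *: 'X^k = 'X_[v] *: 'X^l :> {poly R} -> u = v /\ k = l.
Proof.
move=> eq_uv.
have X_neq0 x : 'X_[x] != 0 :> R by rewrite -msupp_eq0 msuppX.
have eq_kl : k = l.
  apply/eqP; have /eqP := congr1 (fun p : {poly R} => p`_k) eq_uv.
  rewrite /= !coefZ !coefXn eqxx mulr1; case: (k == l) => //.
  by rewrite mulr0 (negPf (X_neq0 u)).
split=> //; apply: mpolyX_inj; have := congr1 (fun p : {poly R} => p`_k) eq_uv.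
by rewrite /= !coefZ !coefXn eqxx eq_kl eqxx !mulr1.
Qed.

(** The degree recovers the number of factors, which is not part of the data
over K[T]. *)
Lemma mdeg_total (s : seq F) : mdeg (total s) = (size s * m)%N.
Proof.
rewrite /total; elim: s => [|a s IH]; first by rewrite big_nil mdeg0.
rewrite big_cons mdegD IH mulSn mdeg_sum; congr (_ + _)%N.
by under eq_bigr do rewrite mdeg1; rewrite sum1_card card_ord.
Qed.

Lemma xexp_neq0 (a : F) : (0 < m)%N -> ~~ (xexp a <= 0)%MM.
Proof.
move=> m_gt0; apply/negP=> /mnm_lepP/(_ (mxvec_index (Ordinal m_gt0) (elt a (Ordinal m_gt0)))).
by rewrite xexpE eqxx mnm0E.
Qed.

End Fibers.

Theorem lemma3p13 (K : fieldType) (m n : nat) (m_gt0 : (0 < m)%N)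
    (le_mn : (m <= n)%N) (D : {set {set 'I_n}}) (cl : seq ('I_n * 'I_n))
    (D_complex : simplicial_complex D) (D_pure : pure m D)
    (D_unit_interval : unit_interval m D cl) :
  (forall (u : 'X_{1..m * n}) (k : nat),
     Rees (initial_ideal (@J K m n D)) ('X_[u] *: 'X^k) ->
     exists! M : {mpoly {mpoly K[m * n]}[#|facet m D|]},
       R_fiber ('X_[u] *: 'X^k) M /\ clique_sorted_RT cl M)
  /\
  (forall u : 'X_{1..m * n},
     subalg_gen (fun f => exists a : facet m D, f = xmon K a)
       ('X_[u] : {mpoly K[m * n]}) ->
     exists! N : {mpoly K[#|facet m D|]}, F_fiber 'X_[u] N /\ clique_sorted_KT N).
Proof.
have mn_gt0 : (0 < m * n)%N by rewrite muln_gt0 m_gt0 (leq_trans m_gt0).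
split=> [u k /(Rees_divisible D_complex D_unit_interval mn_gt0)/(_ k u)|u].
  rewrite coefZ coefXn eqxx mulr1 msuppX mem_head => /(_ isT)[s0 [sz0 le0]].
  have [v [s [def_u sz_s srt nb nc]]] :=
    clique_sorted_exists D_complex D_unit_interval le0.
  rewrite sz0 in sz_s; exists (mon_RT K v s); split.
    split; first by split; [exists v, s|rewrite phi_mon def_u sz_s].
    by exists v, s; split=> //; [apply: sorted_lex_ge|apply/cond_aE].
  move=> M [[_ phi_u] [v' [s' [def_M _ /cond_aE srt' nb' nc']]]]; move: phi_u.
  rewrite {M}def_M phi_mon => /monomial_Rees_inj[eq_u sz_s'].
  have eq_s : s = s'.
    apply: (chain_unique D_complex D_unit_interval m_gt0 _ _ srt nb nc srt' nb' nc').
      by rewrite sz_s sz_s'.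
    by rewrite eq_u.
  rewrite -{s' srt' nb' nc' sz_s'}eq_s in eq_u *.
  suff -> : v = v' by [].
  by apply: (@addIm _ (total s)); rewrite eq_u.
move=> /subalg_monomials/(_ u); rewrite msuppX mem_head => /(_ isT)[s0 <-{u}].
have [s [sz_s srt tot_s]] := chain_exists D_complex D_unit_interval s0.
have nb (t : seq (facet m D)) : cond_b 0%MM t by move=> a p q _; rewrite mnm0E.
have nc (t : seq (facet m D)) : cond_c cl 0%MM t.
  by move=> a b le_a0; have := xexp_neq0 a m_gt0; rewrite le_a0.
exists (mon_KT K s); split.
  split; first by split; [exists s|rewrite psi_mon tot_s].
  by exists s; split=> //; [apply: sorted_lex_ge|apply/cond_aE].
move=> N [[_ psi_u] [s' [def_N _ /cond_aE srt']]]; move: psi_u.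
rewrite {N}def_N psi_mon => /mpolyX_inj eq_tot.
have sz_s' : size s = size s'.
  by apply/eqP; rewrite -(eqn_pmul2r m_gt0) -!mdeg_total tot_s eq_tot.
suff -> : s = s' by [].
apply: (chain_unique D_complex D_unit_interval m_gt0 sz_s' _
          srt (nb _) (nc _) srt' (nb _) (nc _)).
by rewrite tot_s eq_tot.
Qed.
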